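(* Let $\mathbb{K}$ be a field and for each partition diagram $\pi$ let $$R_\pi:=\sum_{\sigma\ge\pi}(-1)^{l(\sigma)-l(\pi)}H_\sigma\in\mathrm{ParSym},$$ the sum being over all partition diagrams $\sigma$ that coarsen $\pi$. Then for all non-empty partition diagrams $\pi,\sigma$, $$R_\pi R_\sigma=R_{\pi\otimes\sigma}+R_{\pi\bullet\sigma},$$ and $R_\emptyset$ is the multiplicative identity of $\mathrm{ParSym}$.
   Context: **Partition diagrams.** A partition diagram of order $k\ge 0$ is a set partition of $\{1,\dots,k,1',\dots,k'\}$; for $k=0$ the only one is the empty diagram $\emptyset$. For $\pi$ of order $k$ and $\rho$ of order $m$, $\pi\otimes\rho$ is the diagram of order $k+m$ whose blocks are the blocks of $\pi$ and the blocks of $\rho$ with labels shifted by $k$ ($i\mapsto i+k$, $i'\mapsto (i+k)'$). If $k,m\ge1$, $\pi\bullet\rho$ is obtained from $\pi\otimes\rho$ by merging the block containing $k'$ with the block containing $(k+1)'$. The empty diagram is the unit for both operations. A diagram is $\otimes$-irreducible (resp. $\bullet$-irreducible) if it is not $\rho\otimes\sigma$ (resp. $\rho\bullet\sigma$) with $\rho,\sigma$ both non-empty. Every non-empty $\pi$ is uniquely $\pi_1\otimes\cdots\otimes\pi_l$ with all $\pi_i$ non-empty and $\otimes$-irreducible; $l(\pi):=l$, and $l(\emptyset):=0$. **Refinement.** Every non-empty $\pi$ can be uniquely written $\pi=\pi_1\divideontimes_1\pi_2\divideontimes_2\cdots\divideontimes_{n-1}\pi_n$ with each $\divideontimes_i\in\{\otimes,\bullet\}$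 and each $\pi_i$ non-empty and both $\otimes$- and $\bullet$-irreducible (on non-empty diagrams $\otimes$ and $\bullet$ associate with each other, so no brackets are needed). Put $S(\pi)=\{i\in\{1,\dots,n-1\}:\divideontimes_i=\otimes\}$. For non-empty $\pi,\sigma$ write $\pi\sim\sigma$ if their sequences $(\pi_1,\dots,\pi_n)$ and $(\sigma_1,\dots,\sigma_m)$ are equal; $\sigma$ coarsens $\pi$ (equivalently $\pi\le\sigma$) if $\pi\sim\sigma$ and $S(\sigma)\subseteq S(\pi)$. The empty diagram is related only to itself, with $\emptyset\le\emptyset$. **ParSym.** $\mathrm{ParSym}$ is the $\mathbb{K}$-algebra with vector space basis $\{H_\pi\}$ indexed by all partition diagrams, with product $H_\pi H_\rho=H_{\pi\otimes\rho}$. *)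

(* Defs.v *)
From HB Require Import structures.
From mathcomp Require Import all_boot all_order all_algebra.
From mathcomp Require Import boolp.
From mathcomp.multinomials Require Import monalg.

Set Implicit Arguments.
Unset Strict Implicit.
Unset Printing Implicit Defensive.

Import GRing.Theory.

(* The label i (1 <= i <= k) is inl (i - 1); the label i' is inr (i - 1). *)
Notation label k := ('I_k + 'I_k)%type.

Record diag (k : nat) := Diag {
  blocks : {set {set label k}};
  blocksP : partition blocks [set: label k] }.

HB.instance Definition _ k := [isSub for @blocks k].
HB.instance Definition _ k := [Finite of diag k by <:].

Definition diagram := {k : nat & diag k}.
HB.instance Definition _ := Choice.on diagram.

Definition dorder (pi : diagram) : nat := tag pi.
Definition dgm k (p : diag k) : diagram := Tagged diag p.
Arguments dgm {k} p.

Lemma empty_diag_subproof :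
  partition (set0 : {set {set label 0}}) [set: label 0].
Proof.
apply/and3P; split; first 1 last.
- by apply/trivIsetP => A B; rewrite inE.
- by rewrite inE.
by apply/eqP/setP; case; case.
Qed.

Definition empty_diagram : diagram := dgm (Diag empty_diag_subproof).

Section Tensor.
Variables k m : nat.

Definition lemb (x : label k) : label (k + m) :=
  match x with inl i => inl (lshift m i) | inr i => inr (lshift m i) end.

Definition remb (x : label m) : label (k + m) :=
  match x with inl i => inl (rshift k i) | inr i => inr (rshift k i) end.

Lemma lemb_inj : injective lemb.
Proof. by case=> x [] y //= [/val_inj->]. Qed.

Lemma remb_inj : injective remb.
Proof. by case=> x [] y //= [/addnI/val_inj->]. Qed.

Lemma lremb x y : lemb x <> remb y.
Proof.
by case: x y => x [] y //= [xy]; move: (ltn_ord x); rewrite xy ltnNge leq_addr.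
Qed.

Lemma label_addP (z : label (k + m)) :
  (exists x, z = lemb x) \/ (exists y, z = remb y).
Proof.
case: z => z; rewrite -(splitK z); case: (split z) => x.
- by left; exists (inl x).
- by right; exists (inl x).
- by left; exists (inr x).
- by right; exists (inr x).
Qed.

Definition tensor_blocks (P : {set {set label k}}) (Q : {set {set label m}}) :=
  [set lemb @: B | B : {set label k} in P] :|:
  [set remb @: B | B : {set label m} in Q].

Lemma tensor_subproof (p : diag k) (q : diag m) :
  partition (tensor_blocks (blocks p) (blocks q)) [set: label (k + m)].
Proof.
case: p q => P /and3P[/eqP cP /trivIsetP tP nP]
  [Q /and3P[/eqP cQ /trivIsetP tQ nQ]] /=.
apply/and3P; split.
- apply/eqP/setP => z; rewrite inE; apply/bigcupP.
  have [[x ->]|[x ->]] := label_addP z.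
    have: x \in cover P by rewrite cP inE.
    case/bigcupP => B BP xB; exists (lemb @: B); last exact: imset_f.
    by rewrite inE imset_f.
  have: x \in cover Q by rewrite cQ inE.
  case/bigcupP => B BP xB; exists (remb @: B); last exact: imset_f.
  by rewrite inE orbC imset_f.
- have dis (A : {set label k}) (B : {set label m}) :
      [disjoint lemb @: A & remb @: B].
    apply/pred0P => z /=; apply/negP => /andP[/imsetP[x _ ->]].
    by case/imsetP => y _ /lremb.
  apply/trivIsetP => A B; rewrite !inE.
  case/orP=> /imsetP[A' A'P ->] /orP[] /imsetP[B' B'P ->] neq //.
  + rewrite imset_disjoint; last exact: lemb_inj.
    by apply: tP => //; apply: contraNneq neq => ->.
  + by rewrite disjoint_sym.
  + rewrite imset_disjoint; last exact: remb_inj.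
    by apply: tQ => //; apply: contraNneq neq => ->.
- rewrite !inE; apply/norP; split; apply/imsetP => -[B BP /esym/eqP].
    by rewrite imset_eq0 => /eqP B0; rewrite -B0 BP in nP.
  by rewrite imset_eq0 => /eqP B0; rewrite -B0 BP in nQ.
Qed.

Definition tensor_diag (p : diag k) (q : diag m) : diag (k + m) :=
  Diag (tensor_subproof p q).

End Tensor.

Section Merge.
Variables (T : finType) (P : {set {set T}}) (x y : T).

Definition merge_blocks : {set {set T}} :=
  (pblock P x :|: pblock P y) |: (P :\: [set pblock P x; pblock P y]).

Lemma merge_subproof : partition P [set: T] -> partition merge_blocks [set: T].
Proof.
case/and3P => /eqP cP trP nP; have tP := trivIsetP trP.
have xP z : z \in cover P by rewrite cP inE.
have bP z : pblock P z \in P by rewrite pblock_mem.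
apply/and3P; split.
- apply/eqP/setP => z; rewrite inE; apply/bigcupP.
  have zz : z \in pblock P z by rewrite mem_pblock.
  have [zxy|zxy] := boolP (pblock P z \in [set pblock P x; pblock P y]).
    exists (pblock P x :|: pblock P y); first by rewrite !inE eqxx.
    by move: zxy; rewrite !inE => /orP[]/eqP <-; rewrite zz ?orbT.
  by exists (pblock P z); rewrite // inE [X in _ || X]inE zxy bP orbT.
- have dis B : B \in P :\: [set pblock P x; pblock P y] ->
      [disjoint pblock P x :|: pblock P y & B].
    rewrite !inE negb_or => /andP[/andP[Bx By] BP].
    rewrite -setI_eq0 setIUl setU_eq0 !setI_eq0.
    by rewrite !tP // eq_sym.
  apply/trivIsetP => A B /setU1P[->|AP] /setU1P[->|BP].
  + by rewrite eqxx.
  + by move=> _; apply: dis.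
  + by move=> _; rewrite disjoint_sym; apply: dis.
  by move: AP BP => /setDP[AP _] /setDP[BP _]; apply: tP.
- rewrite !inE (negPf nP) andbF orbF eq_sym setU_eq0 negb_and.
  by apply/orP; left; apply/set0Pn; exists x; rewrite mem_pblock.
Qed.

End Merge.

(* inr ord_max is the label k' of the left factor; inr ord0 is the label 1' of
   the right factor, which becomes (k + 1)'. *)
Definition bullet_diag k m (p : diag k.+1) (q : diag m.+1) :
    diag (k.+1 + m.+1) :=
  Diag (merge_subproof (lemb m.+1 (inr ord_max)) (remb k.+1 (inr ord0))
         (blocksP (tensor_diag p q))).

Definition tensor (pi rho : diagram) : diagram :=
  dgm (tensor_diag (tagged pi) (tagged rho)).

Definition bullet (pi rho : diagram) : diagram :=
  match pi, rho with
  | existT 0 _, _ => rho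
  | existT k.+1 _, existT 0 _ => pi
  | existT k.+1 p, existT m.+1 q => dgm (bullet_diag p q)
  end.

Lemma order_tensor pi rho : dorder (tensor pi rho) = dorder pi + dorder rho.
Proof. by []. Qed.

Lemma order_bullet pi rho : dorder (bullet pi rho) = dorder pi + dorder rho.
Proof. by case: pi rho => [[|k] p] [[|m] q] //=; rewrite /dorder /= addn0. Qed.

Lemma order0 pi : dorder pi = 0 -> pi = empty_diagram.
Proof.
case: pi => k p; rewrite /dorder /= => k0; subst k; congr existT; apply: val_inj.
case: p => P /and3P[_ _ nP] /=; apply/setP => B; rewrite inE.
have -> : B = set0 by apply/setP => -[] [].
exact/negbTE.
Qed.

Lemma order_gt0 pi : (0 < dorder pi) = (pi != empty_diagram).
Proof.
rewrite lt0n; congr negb; apply/eqP/eqP => [/order0 //|-> //].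
Qed.

Definition cast_label k k' (e : k = k') (x : label k) : label k' :=
  match x with inl i => inl (cast_ord e i) | inr i => inr (cast_ord e i) end.

Lemma diagram_eq k k' (e : k = k') (p : diag k) (q : diag k') :
  [set cast_label e @: B | B : {set label k} in blocks p] = blocks q ->
  dgm p = dgm q.
Proof.
case: k' / e q => q pq; congr existT; apply: val_inj; rewrite /= -pq.
rewrite -[LHS]imset_id; apply: eq_imset => B.
rewrite -[LHS]imset_id; apply: eq_imset.
by case=> i /=; rewrite cast_ord_id.
Qed.

Lemma tensor0m : left_id empty_diagram tensor.
Proof.
case=> k p; apply: (@diagram_eq _ _ (add0n k)) => /=.
rewrite /tensor_blocks imset0 set0U -imset_comp -[RHS]imset_id.
apply: eq_imset => B /=; rewrite -imset_comp -[RHS]imset_id; apply: eq_imset.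
by case=> i /=; congr (_ _); apply: val_inj.
Qed.

Lemma tensorm0 : right_id empty_diagram tensor.
Proof.
case=> k p; apply: (@diagram_eq _ _ (addn0 k)) => /=.
rewrite /tensor_blocks imset0 setU0 -imset_comp -[RHS]imset_id.
apply: eq_imset => B /=; rewrite -imset_comp -[RHS]imset_id; apply: eq_imset.
by case=> i /=; congr (_ _); apply: val_inj.
Qed.

Lemma tensorA : associative tensor.
Proof.
case=> k p [m q] [n r]; apply: (@diagram_eq _ _ (addnA k m n)) => /=.
rewrite /tensor_blocks !imsetU -!imset_comp -setUA.
congr (_ :|: (_ :|: _)); apply: eq_imset => B /=; rewrite -!imset_comp;
  apply: eq_imset; case=> i /=; congr (_ _); apply: val_inj => //=.
- by rewrite addnA.
- by rewrite addnA.
Qed.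

Lemma tensor_unit pi rho :
  tensor pi rho = empty_diagram -> pi = empty_diagram /\ rho = empty_diagram.
Proof.
move/(congr1 dorder); rewrite order_tensor => /eqP; rewrite addn_eq0.
by case/andP => /eqP/order0 -> /eqP/order0 ->.
Qed.

HB.instance Definition _ := Choice_isMonomialDef.Build diagram
  tensorA tensor0m tensorm0 tensor_unit.

Definition tensor_irreducible (pi : diagram) : Prop :=
  ~ exists rho sigma, [/\ rho <> empty_diagram, sigma <> empty_diagram
                        & pi = tensor rho sigma].

Definition bullet_irreducible (pi : diagram) : Prop :=
  ~ exists rho sigma, [/\ rho <> empty_diagram, sigma <> empty_diagram
                        & pi = bullet rho sigma].

Definition tensor_factorization (pi : diagram) (s : seq diagram) : Prop :=
  (forall rho, rho \in s -> rho <> empty_diagram /\ tensor_irreducible rho) /\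
  foldr tensor empty_diagram s = pi.

Lemma tensor_factorization_exists pi : exists s, tensor_factorization pi s.
Proof.
have [n] := ubnP (dorder pi); elim: n pi => // n IHn pi; rewrite ltnS => le_pi.
have [->|pi0] := eqVneq pi empty_diagram; first by exists [::].
have [irr|/contrapT[rho [sigma [rho0 sigma0 pi_eq]]]] :=
  pselect (tensor_irreducible pi).
  exists [:: pi]; split; last exact: tensorm0.
  by move=> rho; rewrite inE => /eqP ->; split=> //; apply/eqP.
move: rho0 sigma0 le_pi => /eqP; rewrite -order_gt0 => rho0 /eqP.
rewrite -order_gt0 => sigma0; rewrite pi_eq order_tensor => le_pi.
have [|s [sP s_eq]] := IHn rho.
  by apply: leq_trans le_pi; rewrite -addn1 leq_add2l.
have [|t [tP t_eq]] := IHn sigma.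
  by apply: leq_trans le_pi; rewrite -add1n leq_add2r.
exists (s ++ t); split=> [tau|]; first by rewrite mem_cat => /orP[/sP|/tP].
rewrite foldr_cat t_eq -s_eq; elim: s {sP s_eq} => [|a s IHs] /=.
  by rewrite tensor0m.
by rewrite IHs tensorA.
Qed.

(* The factorization is unique, so the choice made by cid is immaterial; for
   the empty diagram it is the empty sequence. *)
Definition tensor_length (pi : diagram) : nat :=
  size (sval (cid (tensor_factorization_exists pi))).

(* The word (p, [:: (o_1, p_1); ...; (o_n, p_n)]), in which o_i = true stands
   for the tensor operation and o_i = false for the bullet operation, encodes
   the expression p o_1 p_1 o_2 ... o_n p_n. *)
Definition word := (diagram * seq (bool * diagram))%type.

Definition pieces (w : word) : seq diagram := w.1 :: unzip2 w.2.

Definition operations (w : word) : seq bool := unzip1 w.2.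

Definition word_eval (w : word) : diagram :=
  foldl (fun acc x => (if x.1 then tensor else bullet) acc x.2) w.1 w.2.

Definition tensor_positions (w : word) : seq nat :=
  [seq i <- iota 1 (size (operations w)) | nth false (operations w) i.-1].

Definition refinement (pi : diagram) (w : word) : Prop :=
  (forall rho, rho \in pieces w ->
     [/\ rho <> empty_diagram, tensor_irreducible rho
       & bullet_irreducible rho]) /\
  word_eval w = pi.

(* A non-empty diagram has exactly one refinement, and the empty diagram has
   none. *)
Definition coarsens (sigma pi : diagram) : Prop :=
  (pi = empty_diagram /\ sigma = empty_diagram) \/
  exists v w, [/\ refinement pi v, refinement sigma w,
                  pieces v = pieces w
                & {subset tensor_positions w <= tensor_positions v}].

Lemma order_eval w : dorder (word_eval w) = sumn (map dorder (pieces w)).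
Proof.
case: w => p s; rewrite /word_eval /pieces /=.
elim: s p => [|[o q] s IHs] p /=; first by rewrite addn0.
by rewrite IHs; case: o; rewrite /= ?order_tensor ?order_bullet addnA.
Qed.

Lemma order_coarsens sigma pi : coarsens sigma pi -> dorder sigma = dorder pi.
Proof.
case=> [[-> ->] //|[v [w [[_ <-] [_ <-] vw _]]]].
by rewrite !order_eval vw.
Qed.

Local Open Scope ring_scope.

Notation ParSym K := {malg K[diagram]}.

Definition parH (K : fieldType) (pi : diagram) : ParSym K := << pi >>.

Lemma parH_mul (K : fieldType) pi rho :
  parH K pi * parH K rho = parH K (tensor pi rho).
Proof. by rewrite /parH malgM_def fgmulUU mulr1. Qed.

(* By order_coarsens, every diagram that coarsens pi has the order of pi, so
   the sum below runs over all of them. *)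
Definition parR (K : fieldType) (pi : diagram) : ParSym K :=
  \sum_(s : diag (dorder pi) | `[< coarsens (dgm s) pi >])
     (-1 : K) ^ ((tensor_length (dgm s))%:Z - (tensor_length pi)%:Z)
       *: parH K (dgm s).

(* Main.v *)
Require Import Defs.
From mathcomp Require Import all_boot all_algebra.
From mathcomp Require Import boolp zify.
From mathcomp.multinomials Require Import monalg.
Import GRing.Theory.

Set Implicit Arguments.
Unset Strict Implicit.
Unset Printing Implicit Defensive.

(* The two products of non-empty diagrams associate with each other, and they
   satisfy Levi's lemma: if a o b = c o' d with a shorter than c, then
   c = a o e for some e. Hence every non-empty diagram has exactly one word of
   irreducible pieces, coarsening replaces some tensors of that word by
   bullets, and l is one plus the number of tensors. Writing v and w for the
   words of pi and sigma, the coarsenings of the words v o w with a fixed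
   operation o in the middle are indexed by pairs of coarsenings of v and w;
   the terms of R_(pi tensor sigma) with a bullet in the middle cancel
   R_(pi bullet sigma), and the others form the product. *)

(** * Diagrams as equivalence relations on labels *)

(* Labels of all orders share the type nlabel, in which (false, i) stands for
   the label i + 1 and (true, i) for (i + 1)'; this avoids casts between the
   types diag k when the order is only provably k. *)
Definition nlabel := (bool * nat)%type.

Definition label_nat k (x : label k) : nlabel :=
  match x with inl i => (false, val i) | inr i => (true, val i) end.

Definition shift k (x : nlabel) : nlabel := (x.1, k + x.2).

Lemma label_nat_lt k (a : label k) : (label_nat a).2 < k.
Proof. by case: a => i /=. Qed.

Lemma label_nat_inj k : injective (@label_nat k).
Proof. by case=> i [] j //= [/val_inj->]. Qed.

Lemma label_natP k (x : nlabel) :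
  x.2 < k -> exists a : label k, x = label_nat a.
Proof.
case: x => [[] i] /= ik; first by exists (inr (Ordinal ik)).
by exists (inl (Ordinal ik)).
Qed.

Lemma label_nat_lemb k m (a : label k) : label_nat (lemb m a) = label_nat a.
Proof. by case: a. Qed.

Lemma label_nat_remb k m (b : label m) :
  label_nat (remb k b) = shift k (label_nat b).
Proof. by case: b. Qed.

Lemma shiftP k (x : nlabel) : k <= x.2 -> exists y, x = shift k y.
Proof.
by case: x => b i /= ki; exists (b, i - k); rewrite /shift /= subnKC.
Qed.

(** The relation of lying in a common block, extended by [false] to pairs outside the range of
    labels, so that diagrams of different orders can be compared without casts. *)
Definition joined (pi : diagram) (x y : nlabel) : bool :=
  [exists a : label (dorder pi), [exists b in pblock (blocks (tagged pi)) a,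
     (x == label_nat a) && (y == label_nat b)]].

Lemma joinedE k (p : diag k) (a b : label k) :
  joined (dgm p) (label_nat a) (label_nat b) = (b \in pblock (blocks p) a).
Proof.
apply/existsP/idP => [[a' /existsP[b' /and3P[]]]|ab].
  by move=> /= + /eqP/label_nat_inj-> /eqP/label_nat_inj->.
by exists a; apply/existsP; exists b; rewrite /= ab !eqxx.
Qed.

Lemma joined_lt pi x y : joined pi x y -> x.2 < dorder pi /\ y.2 < dorder pi.
Proof.
by case/existsP=> a /existsP[b /and3P[_ /eqP-> /eqP->]]; rewrite !label_nat_lt.
Qed.

Section Blocks.
Variables (k : nat) (p : diag k).

Lemma diag_trivIset : trivIset (blocks p).
Proof. by have /and3P[] := blocksP p. Qed.

Lemma diag_cover a : a \in cover (blocks p).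
Proof. by have /and3P[/eqP-> _ _] := blocksP p; rewrite inE. Qed.

Lemma pblock_sym a b :
  (b \in pblock (blocks p) a) = (a \in pblock (blocks p) b).
Proof.
by rewrite -!eq_pblock ?diag_cover ?diag_trivIset // eq_sym.
Qed.

Lemma pblock_trans a b c : b \in pblock (blocks p) a ->
  (c \in pblock (blocks p) a) = (c \in pblock (blocks p) b).
Proof. by move/same_pblock->; rewrite ?diag_trivIset. Qed.

End Blocks.

Lemma joined_refl pi x : x.2 < dorder pi -> joined pi x x.
Proof.
case: pi => k p /label_natP[a ->]; rewrite (joinedE p) mem_pblock.
exact: diag_cover.
Qed.

Lemma joined_sym pi x y : joined pi x y = joined pi y x.
Proof.
suff sub u v : joined pi u v -> joined pi v u by apply/idP/idP; apply: sub.
case: pi => k p /[dup] /joined_lt[/label_natP[a ->] /label_natP[b ->]].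
by rewrite !joinedE pblock_sym.
Qed.

Lemma joined_trans pi : transitive (joined pi).
Proof.
case: pi => k p y x z /[dup] /joined_lt[/label_natP[a ->] /label_natP[b ->]].
move=> /[swap] /[dup] /joined_lt[_ /label_natP[c ->]].
rewrite !joinedE => bc ab; by rewrite (pblock_trans _ ab).
Qed.

(** Blocks are non-empty, so each is the block of some label and the relation determines them all.
    By symmetry the pairs with [x.2 <= y.2] suffice, which spares later case splits the pairs
    running from right to left. *)
Lemma diagram_ext pi rho : dorder pi = dorder rho ->
  (forall x y, x.2 <= y.2 -> y.2 < dorder pi ->
     joined pi x y = joined rho x y) ->
  pi = rho.
Proof.
case: pi rho => k p [m q]; rewrite /dorder /= => km; subst m => pq.
have {}pq a : pblock (blocks p) a = pblock (blocks q) a.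
  apply/setP => b; rewrite -!joinedE.
  case: (leqP (label_nat a).2 (label_nat b).2) => [|/ltnW] ab.
    by apply: pq => //; apply: label_nat_lt.
  by rewrite joined_sym [RHS]joined_sym; apply: pq => //; apply: label_nat_lt.
have sub (r s : diag k) :
    (forall a, pblock (blocks r) a = pblock (blocks s) a) ->
    blocks r \subset blocks s.
  move=> rs; apply/subsetP => B Br.
  have /and3P[_ tr n0] := blocksP r.
  have [B0|[a aB]] := set_0Vmem B; first by rewrite -B0 Br in n0.
  by rewrite -(def_pblock tr Br aB) rs pblock_mem // diag_cover.
congr existT; apply: val_inj; apply/eqP; rewrite eqEsubset.
by rewrite !sub // => a; rewrite pq.
Qed.

(** The blocks are the classes of [r] on the labels of order [n]. Since reflexivity is asked only
    there, the relation of a diagram of larger order can be cut down to its first [n] columns. *)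
Lemma diagram_of_rel n (r : rel nlabel) :
  (forall x, x.2 < n -> r x x) -> symmetric r -> transitive r ->
  exists2 pi, dorder pi = n &
    forall x y, x.2 < n -> y.2 < n -> joined pi x y = r x y.
Proof.
move=> rr rs rt; pose R := relpre (@label_nat n) r.
have eqR : {in [set: label n] & &, equivalence_rel R}.
  move=> a b c _ _ _; split; first by apply: rr; apply: label_nat_lt.
  move=> ab; apply/idP/idP; last exact: rt.
  by apply: rt; rewrite /= rs.
pose p := Diag (equivalence_partitionP eqR).
exists (dgm p) => // x y /label_natP[a ->] /label_natP[b ->].
by rewrite joinedE /= pblock_equivalence_partition // inE.
Qed.

(** * The relation of a product *)

Definition op (o : bool) : diagram -> diagram -> diagram :=
  if o then tensor else bullet.

Lemma order_op o pi rho : dorder (op o pi rho) = dorder pi + dorder rho.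
Proof. by case: o; rewrite ?order_tensor ?order_bullet. Qed.

Section Pblock.
Variables (k m : nat) (p : diag k) (q : diag m).

Lemma pblock_lemb a :
  pblock (blocks (tensor_diag p q)) (lemb m a) = lemb m @: pblock (blocks p) a.
Proof.
apply: def_pblock; first exact: diag_trivIset.
  by rewrite inE imset_f // pblock_mem // diag_cover.
by rewrite imset_f // mem_pblock diag_cover.
Qed.

Lemma pblock_remb b :
  pblock (blocks (tensor_diag p q)) (remb k b) =
  @remb k m @: pblock (blocks q) b.
Proof.
apply: def_pblock; first exact: diag_trivIset.
  by rewrite inE orbC imset_f // pblock_mem // diag_cover.
by rewrite imset_f // mem_pblock diag_cover.
Qed.

End Pblock.

Lemma joined_tensor_ll pi rho x y : x.2 < dorder pi -> y.2 < dorder pi ->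
  joined (tensor pi rho) x y = joined pi x y.
Proof.
case: pi rho => k p [m q] /label_natP[a ->] /label_natP[b ->].
rewrite joinedE -(label_nat_lemb m a) -(label_nat_lemb m b).
rewrite (joinedE (tensor_diag p q)).
rewrite pblock_lemb mem_imset //.
exact: lemb_inj.
Qed.

Lemma joined_tensor_rr pi rho x y :
  joined (tensor pi rho) (shift (dorder pi) x) (shift (dorder pi) y)
  = joined rho x y.
Proof.
case: pi rho => k p [m q].
case: (ltnP x.2 m) => [/label_natP[a ->]|mx]; last first.
  apply/idP/idP => /joined_lt[] /=; rewrite /dorder /= ?ltn_add2l => + _; lia.
case: (ltnP y.2 m) => [/label_natP[b ->]|mx]; last first.
  apply/idP/idP => /joined_lt[] _ /=; rewrite /dorder /= ?ltn_add2l => +; lia.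
rewrite joinedE -!label_nat_remb (joinedE (tensor_diag p q)).
rewrite pblock_remb mem_imset //.
exact: remb_inj.
Qed.

Lemma joined_tensor_lr pi rho x y : x.2 < dorder pi ->
  joined (tensor pi rho) x (shift (dorder pi) y) = false.
Proof.
move=> xk; apply/negbTE/negP => xy; have [_] := joined_lt xy.
rewrite order_tensor ltn_add2l; move: xk xy.
case: pi rho => k p [m q] /label_natP[a ->] + /label_natP[b yb]; rewrite yb.
rewrite -(label_nat_lemb m) -label_nat_remb (joinedE (tensor_diag p q)).
by rewrite pblock_lemb => /imsetP[c _ /esym/lremb].
Qed.

(** If the block of [u] is one of the two merged ones, its new block is their union; otherwise it is
    unchanged and the last two alternatives are false. *)
Lemma pblock_merge (T : finType) (P : {set {set T}}) x y u v :
  partition P [set: T] ->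
  (v \in pblock (merge_blocks P x y) u) =
  [|| v \in pblock P u,
      (u \in pblock P x) && (v \in pblock P y) |
      (u \in pblock P y) && (v \in pblock P x)].
Proof.
move=> Pp; have /and3P[/eqP cP trP nP] := Pp.
have /and3P[_ trM _] := merge_subproof x y Pp.
have xP z : z \in cover P by rewrite cP inE.
have uu : u \in pblock P u by rewrite mem_pblock.
have pbE z w : (w \in pblock P z) = (pblock P z == pblock P w).
  by rewrite eq_pblock.
have [uxy|uxy] := boolP (pblock P u \in [set pblock P x; pblock P y]).
  have -> : pblock (merge_blocks P x y) u = pblock P x :|: pblock P y.
    apply: def_pblock => //; first by rewrite !inE eqxx.
    by move: uxy; rewrite !inE => /orP[]/eqP <-; rewrite uu ?orbT.
  move: uxy; rewrite !inE (pbE x u) (pbE y u) => /orP[]/eqP ->; rewrite eqxx /=.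
    by case: (v \in pblock P x); rewrite ?orbT //= andbF orbF.
  by case: (v \in pblock P y); rewrite ?orbT ?orbF ?andbF.
have -> : pblock (merge_blocks P x y) u = pblock P u.
  apply: def_pblock => //.
  by rewrite inE [X in _ || X]inE uxy pblock_mem // orbT.
move: uxy; rewrite !inE negb_or (pbE x u) (pbE y u).
rewrite [pblock P x == _]eq_sym [pblock P y == _]eq_sym.
by move=> /andP[/negPf-> /negPf->]; rewrite orbF.
Qed.

(** The label k' of the left factor; with 1' of the right factor, defined next, it marks the two
    blocks that [bullet] merges. At order 0 the predecessor is 0 and the value is not a label of the
    diagram. *)
Definition last_label (pi : diagram) : nlabel := (true, (dorder pi).-1).
Definition first_label : nlabel := (true, 0).

Lemma joined_bullet pi rho x y : 0 < dorder pi -> 0 < dorder rho ->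
  let l := last_label pi in let f := shift (dorder pi) first_label in
  joined (bullet pi rho) x y =
  [|| joined (tensor pi rho) x y,
      joined (tensor pi rho) l x && joined (tensor pi rho) f y |
      joined (tensor pi rho) f x && joined (tensor pi rho) l y].
Proof.
case: pi rho => [[|k] p] [[|m] q] // _ _.
set l := last_label _; set f := shift _ _; move=> /=.
have lE : l = label_nat (lemb m.+1 (inr (ord_max : 'I_k.+1))) by [].
have fE : f = label_nat (remb k.+1 (inr (ord0 : 'I_m.+1))) by [].
(* Out of range both sides are false; in range the claim is [pblock_merge]. *)
have [xlt|xge] := boolP (x.2 < k.+1 + m.+1); last first.
  apply/idP/idP => [/joined_lt[]|]; first by rewrite /dorder /= (negPf xge).
  by case/or3P => [/joined_lt[]|/andP[/joined_lt[_]]|/andP[/joined_lt[_]]];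
    rewrite /dorder /= (negPf xge).
have [ylt|yge] := boolP (y.2 < k.+1 + m.+1); last first.
  apply/idP/idP => [/joined_lt[_]|]; first by rewrite /dorder /= (negPf yge).
  by case/or3P => [/joined_lt[_]|/andP[_ /joined_lt[_]]|/andP[_ /joined_lt[_]]];
    rewrite /dorder /= (negPf yge).
move: xlt ylt => /label_natP[a ->] /label_natP[b ->].
by rewrite lE fE !joinedE pblock_merge //; apply: (blocksP (tensor_diag p q)).
Qed.

Lemma last_label_lt pi : 0 < dorder pi -> (last_label pi).2 < dorder pi.
Proof. by move=> p0; rewrite /= prednK. Qed.

Section JoinedOp.
Variables (o : bool) (pi rho : diagram).
Hypotheses (pi0 : 0 < dorder pi) (rho0 : 0 < dorder rho).

Let last_lt := last_label_lt pi0.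

(** Merging one block of each factor joins no new pair inside a factor: each extra alternative of
    [joined_bullet] would need a link across the tensor product. *)
Lemma joined_op_ll x y : x.2 < dorder pi -> y.2 < dorder pi ->
  joined (op o pi rho) x y = joined pi x y.
Proof.
move=> xk yk; case: o => /=; first exact: joined_tensor_ll.
rewrite joined_bullet // joined_tensor_ll //.
rewrite [joined _ (shift _ _) x]joined_sym [joined _ (shift _ _) y]joined_sym.
by rewrite !joined_tensor_lr // andbF orbF.
Qed.

Lemma joined_op_rr x y :
  joined (op o pi rho) (shift (dorder pi) x) (shift (dorder pi) y)
  = joined rho x y.
Proof.
case: o => /=; first exact: joined_tensor_rr.
by rewrite joined_bullet // !joined_tensor_rr !joined_tensor_lr // andbF !orbF.
Qed.

Lemma joined_op_lr x y : x.2 < dorder pi ->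
  joined (op o pi rho) x (shift (dorder pi) y) =
  [&& ~~ o, joined pi x (last_label pi) & joined rho first_label y].
Proof.
move=> xk; case: o => /=; first exact: joined_tensor_lr.
rewrite joined_bullet // joined_tensor_lr // joined_tensor_ll //.
rewrite joined_tensor_rr [joined _ (shift _ _) x]joined_sym joined_tensor_lr //.
by rewrite orbF joined_sym.
Qed.

End JoinedOp.

Lemma order_op_gt0 o pi rho :
  0 < dorder pi -> 0 < dorder rho -> 0 < dorder (op o pi rho).
Proof. by rewrite order_op => ? ?; rewrite addn_gt0; apply/orP; left. Qed.

(** * Mutual associativity, cancellation and Levi's lemma *)

Lemma shift_add k m x : shift (k + m) x = shift k (shift m x).
Proof. by rewrite /shift /= addnA. Qed.

Lemma last_label_op o pi rho : 0 < dorder rho ->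
  last_label (op o pi rho) = shift (dorder pi) (last_label rho).
Proof.
by move=> r0; rewrite /last_label /shift order_op /=; congr pair; lia.
Qed.

(** Both sides have the same relation, by cases on the factors that contain [x] and [y]. *)
Lemma opA o o' a b c : 0 < dorder a -> 0 < dorder b -> 0 < dorder c ->
  op o' (op o a b) c = op o a (op o' b c).
Proof.
move=> a0 b0 c0.
have ab0 := order_op_gt0 o a0 b0; have bc0 := order_op_gt0 o' b0 c0.
have ltl (u : nlabel) : u.2 < dorder a -> u.2 < dorder (op o a b).
  by rewrite order_op; apply: ltn_addr.
have ltr (u : nlabel) : u.2 < dorder b ->
    (shift (dorder a) u).2 < dorder (op o a b).
  by rewrite order_op ltn_add2l.
have shiftE u : shift (dorder a) (shift (dorder b) u) =
    shift (dorder (op o a b)) u by rewrite order_op shift_add.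
apply: diagram_ext => [|x y xy _]; first by rewrite !order_op addnA.
have [ya|ya] := ltnP y.2 (dorder a).
  have xa := leq_ltn_trans xy ya.
  by rewrite !joined_op_ll //; apply: ltl.
have [y1 yE] := shiftP ya; subst y.
have [xa|xa] := ltnP x.2 (dorder a).
  rewrite [RHS]joined_op_lr //.
  have [yb|yb] := ltnP y1.2 (dorder b).
    rewrite joined_op_ll //; [|exact: ltl|exact: ltr].
    by rewrite joined_op_lr // joined_op_ll.
  have [y2 yE] := shiftP yb; subst y1.
  (* With [x] in [a] and [y] in [c], both sides require two bullets, [x] joined to the last label of
     [a], the first and last labels of [b] joined, and the first label of [c] joined to [y]. *)
  rewrite shiftE joined_op_lr //; last exact: ltl.
  rewrite last_label_op // !joined_op_lr //.
  by case: (o); case: (o') => //=; rewrite ?andbF ?andbA.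
have [x1 xE] := shiftP xa; subst x.
rewrite [RHS]joined_op_rr //; move: xy; rewrite /= leq_add2l => xy.
have [yb|yb] := ltnP y1.2 (dorder b).
  have xb := leq_ltn_trans xy yb.
  rewrite joined_op_ll //; [|exact: ltr..].
  by rewrite joined_op_rr // joined_op_ll.
have [y2 yE] := shiftP yb; subst y1.
have [xb|xb] := ltnP x1.2 (dorder b).
  rewrite shiftE joined_op_lr //; last exact: ltr.
  by rewrite last_label_op // joined_op_rr // joined_op_lr.
have [x2 xE] := shiftP xb; subst x1.
by rewrite !shiftE !joined_op_rr.
Qed.

(** Once the cut is known, the product determines its parts: the operation is a bullet exactly when
    the two primed labels next to the cut are joined, and the factors are the restrictions to the
    two sides. *)
Lemma op_inj o o' a b c d : 0 < dorder a -> 0 < dorder b -> 0 < dorder c ->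
  0 < dorder d -> dorder a = dorder c -> op o a b = op o' c d ->
  [/\ o = o', a = c & b = d].
Proof.
move=> a0 b0 c0 d0 ac E.
have bd : dorder b = dorder d.
  by move/(congr1 dorder): E; rewrite !order_op ac => /addnI.
have J x y : joined (op o a b) x y = joined (op o' c d) x y by rewrite E.
split.
- have := J (last_label a) (shift (dorder a) first_label).
  rewrite {2}ac !joined_op_lr ?last_label_lt //; last first.
    by rewrite -ac last_label_lt.
  rewrite /last_label -ac !joined_refl //; first by case: (o); case: (o').
  + by rewrite /= -ac prednK.
  + by rewrite /= prednK.
- apply: diagram_ext => // x y xy ya; have xa := leq_ltn_trans xy ya.
  by have := J x y; rewrite !joined_op_ll // -ac.
apply: diagram_ext => // x y _ _.
have := J (shift (dorder a) x) (shift (dorder a) y).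
by rewrite {3 4}ac !joined_op_rr.
Qed.

(** Levi's lemma. The witness [e] is [b] restricted to its first [n] columns; both [c] and
    [op o a e] are then the restriction of the common product to the columns of [c]. *)
Lemma op_split o o' a b c d : 0 < dorder a -> 0 < dorder b -> 0 < dorder c ->
  0 < dorder d -> dorder a < dorder c -> op o a b = op o' c d ->
  exists e, 0 < dorder e /\ c = op o a e.
Proof.
move=> a0 b0 c0 d0 ac E; set n := dorder c - dorder a.
have nb : n <= dorder b.
  by move/(congr1 dorder): E; rewrite !order_op /n; lia.
have [|||e en eE] := @diagram_of_rel n (joined b).
- by move=> x xn; apply: joined_refl; apply: leq_trans nb.
- exact: joined_sym.
- exact: joined_trans.
have e0 : 0 < dorder e by rewrite en subn_gt0.
exists e; split=> //; apply: diagram_ext => [|x y xy yc].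
  by rewrite order_op en subnKC // ltnW.
have xc := leq_ltn_trans xy yc.
rewrite -(joined_op_ll o' c0 d0 xc yc) -E.
have [ya|ya] := ltnP y.2 (dorder a).
  by have xa := leq_ltn_trans xy ya; rewrite !joined_op_ll.
have [y1 yE] := shiftP ya; subst y.
have {}yc : y1.2 < n by move: yc; rewrite /= /n; lia.
have [xa|xa] := ltnP x.2 (dorder a).
  by rewrite !joined_op_lr // eE // -en.
have [x1 xE] := shiftP xa; subst x.
by rewrite !joined_op_rr // eE //; move: xc; rewrite /= /n; lia.
Qed.

Lemma order_gt0P pi : reflect (pi <> empty_diagram) (0 < dorder pi).
Proof. by rewrite Defs.order_gt0; apply: (iffP idP) => /eqP. Qed.

(** * Existence and uniqueness of the word of irreducible pieces *)

Definition prime_word (w : word) : Prop := forall rho, rho \in pieces w ->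
  [/\ rho <> empty_diagram, tensor_irreducible rho & bullet_irreducible rho].

Definition nonempty_word (w : word) : Prop :=
  forall rho, rho \in pieces w -> 0 < dorder rho.

Lemma prime_word_nonempty w : prime_word w -> nonempty_word w.
Proof. by move=> pw rho /pw[/order_gt0P]. Qed.

Lemma nonempty_cons p o q s :
  nonempty_word (p, (o, q) :: s) -> 0 < dorder p /\ nonempty_word (q, s).
Proof.
move=> ne; split=> [|rho rho_s]; first by apply: ne; rewrite inE eqxx.
by apply: ne; rewrite inE rho_s orbT.
Qed.

Lemma prime_cons p o q s :
  prime_word (p, (o, q) :: s) -> prime_word (p, [::]) /\ prime_word (q, s).
Proof.
move=> pr; split=> [rho|rho rho_s].
  by rewrite inE => /eqP->; apply: pr; rewrite inE eqxx.
by apply: pr; rewrite inE rho_s orbT.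
Qed.

Lemma order_eval_gt0 w : nonempty_word w -> 0 < dorder (word_eval w).
Proof.
move=> ne; rewrite order_eval /= addn_gt0; apply/orP; left.
by apply: ne; rewrite inE eqxx.
Qed.

Lemma word_eval_step o p q s :
  word_eval (p, (o, q) :: s) = word_eval (op o p q, s).
Proof. by []. Qed.

(** Evaluation nests to the left, whereas induction on words has to split off the first piece; [opA]
    mediates, with [b] absorbing the pieces one by one. *)
Lemma word_eval_op o a b s :
  0 < dorder a -> nonempty_word (b, s) ->
  word_eval (op o a b, s) = op o a (word_eval (b, s)).
Proof.
move=> a0; elim: s b => [//|[o' q] s IHs] b /nonempty_cons[b0 ne].
have q0 : 0 < dorder q by apply: ne; rewrite inE eqxx.
rewrite !word_eval_step opA //; apply: IHs => rho.
rewrite inE => /orP[/eqP->|rho_s]; first exact: order_op_gt0.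
by apply: ne; rewrite inE; apply/orP; right.
Qed.

Lemma word_eval_cons o p q s : nonempty_word (p, (o, q) :: s) ->
  word_eval (p, (o, q) :: s) = op o p (word_eval (q, s)).
Proof. by case/nonempty_cons; apply: word_eval_op. Qed.

Definition word_cat (o : bool) (v w : word) : word :=
  (v.1, v.2 ++ (o, w.1) :: w.2).

Lemma pieces_cat o v w : pieces (word_cat o v w) = pieces v ++ pieces w.
Proof. by rewrite /pieces /unzip2 map_cat. Qed.

Lemma operations_cat o v w :
  operations (word_cat o v w) = operations v ++ o :: operations w.
Proof. by rewrite /operations /unzip1 map_cat. Qed.

Lemma prime_cat o v w :
  prime_word v -> prime_word w -> prime_word (word_cat o v w).
Proof. by move=> pv pw rho; rewrite pieces_cat mem_cat => /orP[/pv|/pw]. Qed.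

Lemma word_eval_cat o v w : nonempty_word v -> nonempty_word w ->
  word_eval (word_cat o v w) = op o (word_eval v) (word_eval w).
Proof.
case: v w => p s [q t] nv nw.
transitivity (word_eval (op o (word_eval (p, s)) q, t)).
  by rewrite /word_eval /= foldl_cat.
by rewrite word_eval_op // order_eval_gt0.
Qed.

Lemma prime_word_op p o a b :
  prime_word (p, [::]) -> p = op o a b -> 0 < dorder a -> 0 < dorder b -> False.
Proof.
move=> /(_ p); rewrite inE eqxx => /(_ isT)[_ ti bi] pE.
move=> /order_gt0P a0 /order_gt0P b0.
by case: o pE => pE; [apply: ti|apply: bi]; exists a, b.
Qed.

(** Compare the first pieces. If their orders differ, [op_split] factors the longer one, against
    irreducibility; if they agree, [op_inj] removes the first piece and its operation. *)
Lemma prime_word_inj v w :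
  prime_word v -> prime_word w -> word_eval v = word_eval w -> v = w.
Proof.
case: v w => p s [p' s'].
elim: s p p' s' => [|[o q] s IHs] p p' [|[o' q'] s'] pv pw.
- by rewrite /word_eval /= => ->.
- have nw := prime_word_nonempty pw; have [p'0 nw'] := nonempty_cons nw.
  rewrite (word_eval_cons nw) => /(prime_word_op pv)-/(_ p'0).
  by rewrite order_eval_gt0 // => /(_ isT).
- have nv := prime_word_nonempty pv; have [p0 nv'] := nonempty_cons nv.
  rewrite (word_eval_cons nv) => /esym/(prime_word_op pw)-/(_ p0).
  by rewrite order_eval_gt0 // => /(_ isT).
have nv := prime_word_nonempty pv; have [p0 nv'] := nonempty_cons nv.
have nw := prime_word_nonempty pw; have [p'0 nw'] := nonempty_cons nw.
have e0 := order_eval_gt0 nv'; have e0' := order_eval_gt0 nw'.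
have [pp pv'] := prime_cons pv; have [pp' pw'] := prime_cons pw.
rewrite (word_eval_cons nv) (word_eval_cons nw) => E.
case: (ltngtP (dorder p) (dorder p')) => [lt|lt|eq].
- have [e [e_gt0 p'E]] := op_split p0 e0 p'0 e0' lt E.
  by have := prime_word_op pp' p'E p0 e_gt0.
- have [e [e_gt0 pE]] := op_split p'0 e0' p0 e0 lt (esym E).
  by have := prime_word_op pp pE p'0 e_gt0.
have [-> -> eqe] := op_inj p0 e0 p'0 e0' eq E.
by have [-> ->] := IHs _ _ _ pv' pw' eqe.
Qed.

Lemma prime_word_exists pi : 0 < dorder pi ->
  exists2 w, prime_word w & word_eval w = pi.
Proof.
have [n] := ubnP (dorder pi); elim: n pi => // n IHn pi.
rewrite ltnS => le_pi pi0.
have split_op o : (exists rho sigma, [/\ rho <> empty_diagram,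
    sigma <> empty_diagram & pi = op o rho sigma]) ->
    exists2 w, prime_word w & word_eval w = pi.
  case=> rho [sigma [/order_gt0P rho0 /order_gt0P sigma0 piE]].
  have := order_op o rho sigma; rewrite -piE => ord.
  have [||v pv vE] := IHn rho => //; first by lia.
  have [||w pw wE] := IHn sigma => //; first by lia.
  exists (word_cat o v w); first exact: prime_cat.
  by rewrite word_eval_cat ?vE ?wE //; apply: prime_word_nonempty.
have [ti|/contrapT /(split_op true) //] := pselect (tensor_irreducible pi).
have [bi|/contrapT /(split_op false) //] := pselect (bullet_irreducible pi).
exists (pi, [::]) => // rho; rewrite inE => /eqP->; split=> //.
exact/order_gt0P.
Qed.

(** * The number of tensor factors *)

(** Cutting the word at a tensor would write its value as a tensor product of two non-empty
    diagrams. *)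
Lemma tensor_irreducible_count w : prime_word w ->
  tensor_irreducible (word_eval w) -> count id (operations w) = 0.
Proof.
move=> pw ti; apply/eqP; rewrite -leqn0 leqNgt -has_count; apply/negP.
rewrite /operations has_map => /hasP[[o q] /path.splitPr oq /= o_true].
case: w pw ti oq => p s /= pw ti; case E: _ / => [s1 s2]; subst.
pose v : word := (p, s1); pose u : word := (q, s2).
have ne : nonempty_word (word_cat o v u) by apply: prime_word_nonempty.
have nv : nonempty_word v.
  by move=> rho ?; apply: ne; rewrite pieces_cat mem_cat; apply/orP; left.
have nu : nonempty_word u.
  by move=> rho ?; apply: ne; rewrite pieces_cat mem_cat; apply/orP; right.
apply: ti; exists (word_eval v), (word_eval u).
split; [exact/order_gt0P/order_eval_gt0 | exact/order_gt0P/order_eval_gt0 |].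
by rewrite (word_eval_cat o nv nu) o_true.
Qed.

(** The words of the factors, which contain no tensor themselves, are concatenated with one tensor
    between neighbours. *)
Lemma tensor_factors_word a s :
  (forall rho, rho \in a :: s ->
     rho <> empty_diagram /\ tensor_irreducible rho) ->
  exists w, [/\ prime_word w, word_eval w = foldr tensor empty_diagram (a :: s)
              & count id (operations w) = size s].
Proof.
elim: s a => [|b s IHs] a irr; have [/order_gt0P a0 ti] := irr a (mem_head _ _).
  have [w pw wE] := prime_word_exists a0.
  exists w; rewrite /= tensorm0; split=> //.
  by apply: tensor_irreducible_count; rewrite ?wE.
have [w pw wE] := prime_word_exists a0.
have [|v [pv vE vs]] := IHs b.
  by move=> rho rho_s; apply: irr; rewrite inE rho_s orbT.
exists (word_cat true w v); split.
- exact: prime_cat.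
- by rewrite word_eval_cat ?wE ?vE //; apply: prime_word_nonempty.
rewrite operations_cat count_cat /= vs tensor_irreducible_count //.
by rewrite wE.
Qed.

(** Whichever factorization [cid] picks, its word from [tensor_factors_word] is [w] by uniqueness,
    so the number of factors can be read off [w]. *)
Lemma tensor_length_eval w : prime_word w ->
  tensor_length (word_eval w) = (count id (operations w)).+1.
Proof.
move=> pw; rewrite /tensor_length; case: cid => -[|a s] [irr sE] /=.
  have := order_eval_gt0 (prime_word_nonempty pw).
  by rewrite -sE.
have [v [pv vE vs]] := tensor_factors_word irr.
rewrite -vs; congr (count id (operations _)).+1.
by apply: prime_word_inj; rewrite // vE.
Qed.

(** * Coarsenings as bit sequences *)

(** The subsets of the set of tensor positions, as bit sequences: a [true] (tensor) may turn into
    [false] (bullet), never the reverse. The recursive form makes concatenation split into pairs. *)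
Fixpoint sub_bits (s : bitseq) : seq bitseq :=
  if s is b :: s' then
    (if b then [seq true :: t | t <- sub_bits s'] else [::]) ++
    [seq false :: t | t <- sub_bits s']
  else [:: [::]].

Lemma mem_map_cons (b c : bool) (t : bitseq) S :
  (b :: t \in [seq c :: u | u <- S]) = (b == c) && (t \in S).
Proof.
apply/mapP/andP => [[u uS [-> ->]] //|[/eqP-> tS]]; by exists t.
Qed.

Lemma sub_bitsP (s t : bitseq) :
  reflect (size t = size s /\ forall i, nth false t i -> nth false s i)
          (t \in sub_bits s).
Proof.
elim: s t => [|b s IHs] [|c t] /=.
- by rewrite inE; apply: (iffP idP).
- by rewrite inE; apply: (iffP idP) => // -[].
- apply: (iffP idP) => [|[]//].
  by rewrite mem_cat => /orP[]; [case: b => //|]; case/mapP.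
have -> : (c :: t \in (if b then [seq true :: u | u <- sub_bits s] else [::]) ++
    [seq false :: u | u <- sub_bits s]) = (c ==> b) && (t \in sub_bits s).
  by rewrite mem_cat mem_map_cons; case: b; rewrite ?mem_map_cons; case: c;
    case: (t \in _).
apply: (iffP andP) => [[cb /IHs[st sub]]|[[st] sub]].
  by split; [rewrite st|case=> [|i] /=; [exact/implyP|exact: sub]].
split; first by apply/implyP; apply: (sub 0).
by apply/IHs; split=> // i; apply: (sub i.+1).
Qed.

Lemma uniq_sub_bits s : uniq (sub_bits s).
Proof.
elim: s => //= b s IHs.
have inj c : injective (cons c : bitseq -> bitseq) by move=> t u [].
rewrite cat_uniq map_inj_uniq // IHs andbT.
case: b; rewrite ?map_inj_uniq ?IHs //=; last by apply/hasPn.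
by apply/hasPn => _ /mapP[t _ ->]; apply/mapP => -[].
Qed.

Lemma sub_bits_cat s t :
  sub_bits (s ++ t) = [seq x ++ y | x <- sub_bits s, y <- sub_bits t].
Proof.
elim: s => [|b s IHs] /=; first by rewrite cats0 map_id.
rewrite IHs allpairs_cat; congr (_ ++ _); first case: b => //.
  by rewrite allpairs_mapl map_allpairs.
by rewrite allpairs_mapl map_allpairs.
Qed.

Lemma tensor_positionsP w i :
  reflect (0 < i /\ nth false (operations w) i.-1) (i \in tensor_positions w).
Proof.
rewrite mem_filter mem_iota add1n; apply: (iffP andP).
  by case=> ? /andP[].
case=> i0 ni.
split=> //; rewrite i0 ltnS; case: i i0 ni => //= i _ ni.
(* Past the end [nth] returns the default [false], so a [true] entry forces the upper bound. *)
by rewrite ltnNge; apply: contraL ni => le; rewrite nth_default.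
Qed.

Lemma tensor_positions_sub v w :
  {subset tensor_positions w <= tensor_positions v} <->
  forall i, nth false (operations w) i -> nth false (operations v) i.
Proof.
split=> [sub i wi|sub i /tensor_positionsP[i0 wi]].
  by have /tensor_positionsP[] // : i.+1 \in tensor_positions v;
     apply/sub/tensor_positionsP.
by apply/tensor_positionsP; split=> //; apply: sub.
Qed.

(** Since [zip] truncates, all pieces survive only if [t] is long enough; hence the size hypothesis
    in the section below. *)
Definition with_operations (w : word) (t : bitseq) : word :=
  (w.1, zip t (unzip2 w.2)).

Lemma size_operations w : size (operations w) = size w.2.
Proof. exact: size_map. Qed.

Section WithOperations.
Variables (w : word) (t : bitseq).
Hypothesis size_t : size t = size (operations w).

Lemma pieces_with_operations : pieces (with_operations w t) = pieces w.
Proof.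
by rewrite /pieces /= unzip2_zip // size_t size_operations size_map.
Qed.

Lemma operations_with_operations : operations (with_operations w t) = t.
Proof.
by rewrite /operations /= unzip1_zip // size_t size_operations size_map.
Qed.

Lemma prime_with_operations : prime_word w -> prime_word (with_operations w t).
Proof. by rewrite /prime_word pieces_with_operations. Qed.

End WithOperations.

Lemma pieces_eq_with_operations v w : pieces v = pieces w ->
  w = with_operations v (operations w).
Proof.
case: v w => p s [q t] [-> st]; rewrite /with_operations /= st.
by rewrite zip_unzip.
Qed.

(** By uniqueness the refinement of [word_eval v] chosen in [coarsens] is [v] itself, so only the
    operations of the other word remain free. *)
Lemma coarsensP v sigma : prime_word v ->
  coarsens sigma (word_eval v) <->
  sigma \in [seq word_eval (with_operations v t)
               | t <- sub_bits (operations v)].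
Proof.
move=> pv; have v0 := order_eval_gt0 (prime_word_nonempty pv).
split=> [[[vE _]|[v' [w [[pv' vE] [pw <-] vw /tensor_positions_sub sub]]]]|].
- by rewrite vE in v0.
- have {pv' vE} vE := prime_word_inj pv' pv vE; subst v'.
  have wE := pieces_eq_with_operations vw.
  rewrite {1}wE; apply: map_f; apply/sub_bitsP; split=> //.
  by move/(congr1 size): vw; rewrite /= !size_operations !size_map => -[].
case/mapP => t /sub_bitsP[st sub] ->; right; exists v, (with_operations v t).
split=> //; first by split=> //; apply: prime_with_operations.
  by rewrite pieces_with_operations.
by apply/tensor_positions_sub; rewrite operations_with_operations.
Qed.

Lemma with_operations_cat o v w s b t : size s = size (operations v) ->
  with_operations (word_cat o v w) (s ++ b :: t) =
  word_cat b (with_operations v s) (with_operations w t).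
Proof.
move=> sv; rewrite /with_operations /word_cat /= /unzip2 map_cat zip_cat //.
by rewrite size_map sv size_operations.
Qed.

(** * Expansion of R over words and the product rule *)

Local Open Scope ring_scope.

(** As -1 is its own inverse, the integer exponent l(sigma) - l(pi) may be replaced by a sum of
    natural numbers; the successors come from [tensor_length_eval]. *)
Lemma signz_subS (K : fieldType) (m n : nat) :
  (-1 : K) ^ (m.+1%:Z - n.+1%:Z) = (-1) ^+ (m + n).
Proof.
by rewrite subzSS expfzDr ?oppr_eq0 ?oner_eq0 // -exprz_inv invrN1 exprD.
Qed.

Lemma parR_eval (K : fieldType) v : prime_word v ->
  parR K (word_eval v) =
  \sum_(t <- sub_bits (operations v))
    (-1) ^+ (count id t + count id (operations v))
      *: parH K (word_eval (with_operations v t)).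
Proof.
move=> pv; rewrite /parR.
pose F sigma := (-1 : K) ^ ((tensor_length sigma)%:Z
  - (tensor_length (word_eval v))%:Z) *: parH K sigma.
pose n := dorder (word_eval v).
pose S := [seq word_eval (with_operations v t) | t <- sub_bits (operations v)].
transitivity (\sum_(sigma <- S) F sigma); last first.
  rewrite big_map big_seq [RHS]big_seq; apply: eq_bigr => t /sub_bitsP[st _].
  rewrite /F !tensor_length_eval //; last exact: prime_with_operations.
  by rewrite operations_with_operations // signz_subS.
transitivity (\sum_(sigma <- [seq dgm s | s : diag n] | sigma \in S) F sigma).
  rewrite big_map big_enum_cond /=; apply: eq_bigl => s.
  by apply/asboolP/idP => /(coarsensP _ pv).
(* Both index lists are free of duplicates and have the same members. *)
rewrite -big_filter; apply: perm_big; apply: uniq_perm.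
- apply: filter_uniq; rewrite map_inj_uniq ?enum_uniq // => s t st.
  exact: (eq_from_Tagged st).
(* Equal values come from equal words, whose operations give back the bit sequences. *)
- rewrite map_inj_in_uniq ?uniq_sub_bits // => s t.
  move=> /sub_bitsP[ss _] /sub_bitsP[ts _] /prime_word_inj E.
  rewrite -(operations_with_operations ss) -(operations_with_operations ts).
  by rewrite E //; apply: prime_with_operations.
(* A coarsening has order [n], so it occurs in the enumeration of [diag n]. *)
move=> sigma; rewrite mem_filter; apply: andb_idr => /(coarsensP _ pv).
move=> /order_coarsens; rewrite -/n; case: sigma => k p; rewrite /dorder /=.
by move=> kn; subst k; apply: map_f; rewrite mem_enum.
Qed.

Lemma scale_parH (K : fieldType) (c : K) pi : c *: parH K pi = << c *g pi >>.
Proof. by apply/malgP => x; rewrite mcoeffZ !mcoeffU mulrnAr mulr1. Qed.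

Section ProductRule.
Variables (K : fieldType) (v w : word).
Hypotheses (pv : prime_word v) (pw : prime_word w).

(** The product of the two expansions with the operation [b] in place of the tensor: [true] gives
    the product of the two R, [false] gives R of the bullet product. *)
Definition bit_sum (b : bool) : ParSym K :=
  \sum_(s <- sub_bits (operations v)) \sum_(t <- sub_bits (operations w))
    ((-1) ^+ (count id s + count id (operations v))
       * (-1) ^+ (count id t + count id (operations w)))
     *: parH K (op b (word_eval (with_operations v s))
                     (word_eval (with_operations w t))).

Lemma parR_mul : parR K (word_eval v) * parR K (word_eval w) = bit_sum true.
Proof.
rewrite !parR_eval // mulr_suml; apply: eq_bigr => s _.
rewrite mulr_sumr; apply: eq_bigr => t _.
by rewrite !scale_parH malgM_def fgmulUU.
Qed.

(** A tensor in the middle may be kept or turned into a bullet; the latter lowers l by one and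
    brings the minus sign. A bullet in the middle has to stay. *)
Lemma parR_cat o : parR K (op o (word_eval v) (word_eval w)) =
  if o then bit_sum true - bit_sum false else bit_sum false.
Proof.
have nv := prime_word_nonempty pv; have nw := prime_word_nonempty pw.
rewrite -word_eval_cat // parR_eval; last exact: prime_cat.
rewrite operations_cat sub_bits_cat big_allpairs_dep.
(* Here [c] is the middle operation of the given word and [b] that of its coarsening. *)
pose G b c := \sum_(s <- sub_bits (operations v))
  \sum_(t <- sub_bits (operations w))
  (-1) ^+ (count id (s ++ b :: t)
           + count id (operations v ++ c :: operations w))
      *: parH K (word_eval (with_operations (word_cat c v w) (s ++ b :: t))).
have GE b c : G b c = (-1) ^+ (b + c) *: bit_sum b.
  rewrite /G /bit_sum scaler_sumr big_seq [RHS]big_seq.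
  apply: eq_bigr => s /sub_bitsP[sv _].
  rewrite scaler_sumr big_seq [RHS]big_seq.
  apply: eq_bigr => t /sub_bitsP[tw _].
  rewrite [RHS]scalerA with_operations_cat; last exact: sv.
  rewrite word_eval_cat; first last.
  - by apply/prime_word_nonempty/prime_with_operations.
  - by apply/prime_word_nonempty/prime_with_operations.
  congr (_ *: _); rewrite -!exprD !count_cat /=; congr (_ ^+ _); lia.
transitivity ((if o then G true o else 0) + G false o).
  case: o => /=; rewrite /G -?big_split ?add0r /=; apply: eq_bigr => s _;
    by rewrite ?big_cat !big_map.
rewrite !GE; case: o => /=; last by rewrite add0r scale1r.
by rewrite sqrrN expr1n scale1r scaleN1r.
Qed.

End ProductRule.

Theorem proposition4p1 (K : fieldType) :
  (forall pi sigma : diagram,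
     pi <> empty_diagram -> sigma <> empty_diagram ->
     parR K pi * parR K sigma
     = parR K (tensor pi sigma) + parR K (bullet pi sigma)) /\
  parR K empty_diagram = 1.
Proof.
split=> [pi sigma /order_gt0P/prime_word_exists[v pv <-]
          /order_gt0P/prime_word_exists[w pw <-]|].
  rewrite parR_mul // -[tensor _ _]/(op true _ _) -[bullet _ _]/(op false _ _).
  by rewrite !parR_cat // subrK.
(* Order 0 has a single diagram, so the sum has one term, with sign exponent 0. *)
have empty0 (s : diag 0) : dgm s = empty_diagram by apply: order0.
rewrite /parR (big_pred1 (tagged empty_diagram)) => [|s].
  by rewrite empty0 subrr expr0z scale1r /parH.
have -> : s = tagged empty_diagram by apply: (eq_from_Tagged (empty0 s)).
by rewrite /= eqxx; apply/asboolP; left.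
Qed.
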